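(* Let $X,Y$ be Banach spaces and let $u:\mathbb{R}_{\ge 0}\to\mathcal{L}(X;Y)$ be a function. Then the following are equivalent: (a) for each $x\in X$ there is $t_x\ge 0$ such that the orbit $u_x$ is absolutely continuous on $(t_x,\infty)$; (b) there is $t\ge 0$ such that for all $x\in X$ the orbit $u_x$ is absolutely continuous on $(t,\infty)$.
   Context: $X,Y$ are Banach spaces over the same field $\mathbb{R}$ or $\mathbb{C}$; $\mathcal{L}(X;Y)$ is the space of bounded linear operators from $X$ to $Y$; $\mathbb{R}_{\ge 0}=[0,\infty)$. No continuity or other regularity of $u$ is assumed. For $x\in X$, the orbit is the function $u_x:\mathbb{R}_{\ge 0}\to Y$, $u_x(t)=u(t)x$. A function $f$ is absolutely continuous on a (possibly unbounded) interval $J$ if for every $\varepsilon>0$ there is $\delta>0$ such that $\sum_{k=1}^l\|f(b_k)-f(a_k)\|<\varepsilon$ for every finite family of pairwise disjoint subintervals of $J$ with endpoints $a_k<b_k$ in $J$ ($k=1,\dots,l$) and $\sum_{k=1}^l(b_k-a_k)<\delta$. *)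

(* Defs.v *)
From HB Require Import structures.
From mathcomp Require Import all_boot all_order all_algebra.
From mathcomp Require Import complex.
From mathcomp Require Import all_classical all_reals all_analysis.

Set Implicit Arguments.
Unset Strict Implicit.
Unset Printing Implicit Defensive.

Import Order.TTheory GRing.Theory Num.Theory.
Import numFieldNormedType.Exports.

Local Open Scope classical_set_scope.
Local Open Scope ring_scope.
Local Open Scope complex_scope.

Variant real_or_complex (R : realType) : numFieldType -> Prop :=
| RealScalars : real_or_complex R R
| ComplexScalars : real_or_complex R R[i].

Record bounded_operator (K : numFieldType) (X Y : normedModType K) :=
  BoundedOperator {
    operator_linear :> {linear X -> Y};
    operator_bounded :
      exists M : K, forall x : X, `|operator_linear x| <= M * `|x| }.

Definition orbit_of (R : realType) (K : numFieldType) (X Y : normedModType K)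
    (u : {nonneg R} -> bounded_operator X Y) (x : X) : {nonneg R} -> Y :=
  fun t => u t x.

(* Norms take their values in the scalar field K, hence so does eps; over
   K = R[i], 0 < eps says that eps is a positive real.
   The subintervals of J are represented by their interiors: intervals with
   endpoints a k < b k, chosen half-open for instance, are disjoint as soon as
   their interiors are. *)
Definition absolutely_continuous_on (R : realType) (K : numFieldType)
    (Y : normedModType K) (f : {nonneg R} -> Y) (J : interval {nonneg R}) :=
  forall eps : K, 0 < eps -> exists2 delta : R, 0 < delta &
    forall (l : nat) (a b : 'I_l -> {nonneg R}),
      (forall k, [/\ a k \in J, b k \in J & a k < b k]) ->
      trivIset [set: 'I_l] (fun k => [set` `]a k, b k[]) ->
      \sum_(k < l) ((b k)%:num - (a k)%:num) < delta ->
      \sum_(k < l) `|f (b k) - f (a k)| < eps.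

(* Main.v *)
Require Import Defs.
From mathcomp Require Import all_boot all_order all_algebra.
From mathcomp Require Import complex.
From mathcomp Require Import all_classical all_reals all_analysis.

Local Open Scope classical_set_scope.
Local Open Scope ring_scope.

Import Order.TTheory GRing.Theory Num.Theory.
Import numFieldNormedType.Exports.

(** The orbit of [x] is absolutely continuous on [(t, oo)] when its variation
over finite families of disjoint intervals of small total length is small.
For a fixed family, this variation is a continuous seminorm of [x], since each
operator is bounded; so the question is about a union of countably many sets of
vectors that are described by seminorms, and Baire's category theorem answers
it.

It is used twice. The set [variation_le1 n 1/(n+1)] of the vectors whose orbit
varies by at most 1 over the families in [(n, oo)] of length less than
[1/(n+1)] is closed ([closed_variation_le1]), and these sets cover [X] if every
orbit is eventually absolutely continuous. Hence one of them contains a ball, and because it is cut out by seminorms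
this means that the variations over such families are equicontinuous at 0
([ball_equicontinuous]).

This bound alone does not make any orbit absolutely continuous, as it does not
shrink with the length of the families. What it gives is that, for [t >= n], the
subspace [ac_vectors t] of the vectors with an absolutely continuous orbit on
[(t, oo)] is closed: near a vector of this subspace, the orbit varies almost as
little ([closed_ac_vectors]). The subspaces [ac_vectors (n + m)], for [m]
natural, cover [X] too, so a second use of the category theorem makes one of
them contain a ball, and a subspace that contains a ball is the whole space
([ball_ac_vectors]).

Scalars being real or complex, norms and radii live in a field that need not be
totally ordered. The category theorem is therefore proved here over any number
field in which the inverses of the natural numbers tend to 0
([closed_cover_ball]). *)

(** * The category theorem over real or complex scalars *)

Definition archimedean_scalars (K : numFieldType) :=
  forall e : K, 0 < e -> exists n : nat, n.+1%:R^-1 < e.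

Lemma realType_archimedean (R : realType) : archimedean_scalars R.
Proof.
move=> e e0; exists (Num.truncn e^-1).
by rewrite -ltf_pV2 ?posrE ?invr_gt0 ?ltr0n// invrK truncnS_gt.
Qed.

Lemma real_or_complex_archimedean (R : realType) (K : numFieldType) :
  real_or_complex R K -> archimedean_scalars K.
Proof.
case=> [|[a b]]; first exact: realType_archimedean.
rewrite ltcE /= => /andP[/eqP -> /realType_archimedean[n na]]; exists n.
have -> : (n.+1%:R^-1 : complex R) = (n.+1%:R^-1)%:C%C.
  by rewrite rmorphV ?unitfE ?pnatr_eq0// rmorph_nat.
by rewrite ltcE /= eqxx.
Qed.

Section Baire.
Context {K : numFieldType} {X : completeNormedModType K}.

(** The inductive step of the category theorem: a closed set without interior
leaves room, in any ball, for a smaller ball that it does not meet. *)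
Lemma closed_avoiding_ball (F : set X) (x : X) (r e : K) :
  closed F -> (forall y (s : K), 0 < s -> ~ ball y s `<=` F) -> 0 < r -> 0 < e ->
  exists y s, [/\ 0 < s, s < e &
    forall z, `|y - z| <= s -> `|x - z| <= r /\ ~ F z].
Proof.
move=> Fc Fn r0 e0.
have /existsNP[y] := Fn x r r0.
rewrite not_implyE -ball_normE /ball_ /= => -[xyr Fy].
have : open_nbhs y (~` F) by split=> //; exact: closed_openC.
move=> /open_nbhs_nbhs/nbhs_ballP[/= d d0]; rewrite -ball_normE => dF.
have xyr0 : 0 < r - `|x - y| by rewrite subr_gt0.
(* In a numFieldType, which need not be totally ordered, two positive
   elements are still comparable, so that minima behave as usual. *)
pose m := Num.min (Num.min d e) (r - `|x - y|).
have de_real : (d >=< e)%O by apply: real_comparable; exact: gtr0_real.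
have de0 : 0 < Num.min d e by case: (comparable_leP de_real).
have m_real : (Num.min d e >=< r - `|x - y|)%O.
  by apply: real_comparable; exact: gtr0_real.
have m0 : 0 < m by rewrite /m; case: (comparable_leP m_real).
have mde : m <= Num.min d e by rewrite /m comparable_ge_min// lexx.
have mr : m <= r - `|x - y| by rewrite /m comparable_ge_min// lexx orbT.
have md : m <= d by rewrite (le_trans mde)// comparable_ge_min// lexx.
have me : m <= e by rewrite (le_trans mde)// comparable_ge_min// lexx orbT.
have m2 : m / 2 < m by rewrite gtr_pMr// invf_lt1// ltr1n.
exists y, (m / 2); split; [by rewrite divr_gt0|exact: lt_le_trans me|].
move=> z yz; split; last first.
  by apply: dF; rewrite /ball_ /= (le_lt_trans yz)// (lt_le_trans m2).
rewrite (le_trans (ler_distD y _ _))// -lerBrDl (le_trans yz)//.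
by rewrite (le_trans (ltW m2)).
Qed.

(** If no closed set [F n] contained a ball, nested balls avoiding [F 0], [F 1]
and so on, with radii tending to 0, would shrink to a point outside all of
them. *)
Lemma closed_cover_ball (F : (set X)^nat) : archimedean_scalars K ->
  (forall n, closed (F n)) -> (forall x, exists n, F n x) ->
  exists n x (r : K), 0 < r /\ ball x r `<=` F n.
Proof.
move=> Karch Fc Fcover; apply: contrapT => Fball.
have Fn n y (s : K) : 0 < s -> ~ ball y s `<=` F n.
  by move=> s0 yF; apply: Fball; exists n, y, s.
(* [p] stands for a stage [n] and a ball, and [q] for the next ball. The
   positivity of the radius is an assumption inside the statement so that a
   total choice function exists. *)
have step (p : nat * (X * K)) : exists q : X * K, 0 < p.2.2 ->
    [/\ 0 < q.2, q.2 < p.1.+1%:R^-1 &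
      forall z, `|q.1 - z| <= q.2 -> `|p.2.1 - z| <= p.2.2 /\ ~ F p.1 z].
  case: p => n [x r] /=; have [r0|nr] := pselect (0 < r); last by exists (x, r).
  have n0 : 0 < n.+1%:R^-1 :> K by rewrite invr_gt0 ltr0n.
  by have [y [s ?]] := closed_avoiding_ball _ x _ _ (Fc n) (Fn n) r0 n0; exists (y, s).
have [f fP] := choice step.
pose fix c n : X * K := if n is p.+1 then f (p, c p) else (0, 1).
have c0 n : 0 < (c n).2 by elim: n => //= n IHn; have [] := fP (n, c n) IHn.
have cP n : (c n.+1).2 < n.+1%:R^-1 /\ forall z, `|(c n.+1).1 - z| <= (c n.+1).2 ->
    `|(c n).1 - z| <= (c n).2 /\ ~ F n z.
  by have [_ ? ?] := fP (n, c n) (c0 n).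
have nested n m : (n <= m)%N -> `|(c n).1 - (c m).1| <= (c n).2.
  have : `|(c m).1 - (c m).1| <= (c m).2 by rewrite subrr normr0 ltW.
  move: {2 3}(c m).1 => z zm nm; elim: m nm zm => [|m IHm].
    by rewrite leqn0 => /eqP ->.
  rewrite leq_eqVlt => /orP[/eqP -> //|nm zm]; apply: IHm => //.
  by have [_ /(_ _ zm)[]] := cP m.
have /cvg_ex[l cl] : cvg ((fun n => (c n).1) @ \oo).
  apply: cauchy_cvg; apply: cauchy_exP => e e0.
  have [n ne] := Karch _ e0; exists (c n.+1).1; exists n.+1 => // m /= nm.
  rewrite -ball_normE /ball_ /= (le_lt_trans (nested _ _ nm))//.
  by rewrite (lt_trans _ ne)//; have [] := cP n.
(* The limit stays in every closed ball, by which it avoids every [F n]. *)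
have lball n : `|(c n).1 - l| <= (c n).2.
  apply/ler_addgt0Pr => e e0.
  have /cvgrPdist_lt/(_ _ e0)[N _ Ne] := cl.
  have := Ne (maxn N n) (leq_maxl _ _); rewrite distrC => Nl.
  rewrite (le_trans (ler_distD (c (maxn N n)).1 _ _))// lerD ?(ltW Nl)//.
  by rewrite nested// leq_maxr.
have [n Fl] := Fcover l.
by have [_ /(_ _ (lball n.+1))[]] := cP n.
Qed.

End Baire.

(** * Short families of intervals *)

Section Variation.
Context {R : realType} {K : numFieldType}.
Local Notation time := {nonneg R}.

Definition short_family (t : time) (delta : R) (l : nat) (a b : 'I_l -> time) :=
  [/\ forall k, [/\ a k \in `]t, +oo[, b k \in `]t, +oo[ & a k < b k],
      trivIset [set: 'I_l] (fun k => [set` `]a k, b k[]) &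
      \sum_(k < l) ((b k)%:num - (a k)%:num) < delta].

Lemma short_family_le (t t' : time) (delta delta' : R) l (a b : 'I_l -> time) :
  t' <= t -> delta <= delta' ->
  short_family t delta l a b -> short_family t' delta' l a b.
Proof.
move=> tt dd [ab dab lab]; split=> //; last exact: lt_le_trans dd.
move=> k; have [ak bk abk] := ab k; split=> //.
  by move: ak; rewrite !in_itv /= !andbT; exact: le_lt_trans.
by move: bk; rewrite !in_itv /= !andbT; exact: le_lt_trans.
Qed.

Lemma absolutely_continuousP (Y : normedModType K) (f : time -> Y) (t : time) :
  absolutely_continuous_on f `]t, +oo[ <->
  forall eps : K, 0 < eps -> exists2 delta : R, 0 < delta &
    forall l a b, short_family t delta l a b ->
      \sum_(k < l) `|f (b k) - f (a k)| < eps.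
Proof.
split=> fac eps /fac[delta delta0 fd]; exists delta => // l a b.
  by case; exact: fd.
by move=> ? ? ?; exact: fd.
Qed.

Lemma absolutely_continuous_le (Y : normedModType K) (f : time -> Y) (t t' : time) :
  t <= t' -> absolutely_continuous_on f `]t, +oo[ ->
  absolutely_continuous_on f `]t', +oo[.
Proof.
move=> tt /absolutely_continuousP fac; apply/absolutely_continuousP.
move=> eps /fac[delta delta0 fd]; exists delta => // l a b.
by move/(short_family_le _ t _ delta _ _ _ tt (lexx _)); exact: fd.
Qed.

End Variation.

(** * The variation of an orbit as a seminorm of the vector *)

Section OrbitVariation.
Context {R : realType} {K : numFieldType}.
Context {X : completeNormedModType K} {Y : normedModType K}.
Variable u : {nonneg R} -> bounded_operator X Y.
Local Notation time := {nonneg R}.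

Definition orbit_variation l (a b : 'I_l -> time) (x : X) : K :=
  \sum_(k < l) `|orbit_of u x (b k) - orbit_of u x (a k)|.

Lemma orbit_variationD l (a b : 'I_l -> time) (x y : X) :
  orbit_variation l a b (x + y) <=
  orbit_variation l a b x + orbit_variation l a b y.
Proof.
rewrite -big_split /=; apply: ler_sum => k _.
by rewrite /orbit_of 2!linearD opprD addrACA ler_normD.
Qed.

Lemma orbit_variationZ l (a b : 'I_l -> time) (c : K) (x : X) :
  orbit_variation l a b (c *: x) = `|c| * orbit_variation l a b x.
Proof.
rewrite mulr_sumr; apply: eq_bigr => k _.
by rewrite /orbit_of 2!linearZ -scalerBr normrZ.
Qed.

Lemma orbit_variationB l (a b : 'I_l -> time) (x y : X) :
  orbit_variation l a b (x - y) <=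
  orbit_variation l a b x + orbit_variation l a b y.
Proof.
rewrite (le_trans (orbit_variationD _ _ _ _ _))// lerD2l.
by rewrite -scaleN1r orbit_variationZ normrN1 mul1r.
Qed.

(** Each operator has its own bound, so [M] depends on the family: uniformity
over families is what the category theorem provides later. *)
Lemma orbit_variation_bounded l (a b : 'I_l -> time) :
  exists2 M : K, 0 <= M & forall x, orbit_variation l a b x <= M * `|x|.
Proof.
have ubound t : exists M : K, 0 <= M /\ forall x, `|u t x| <= M * `|x|.
  have [M uM] := operator_bounded (u t); exists `|M|; split=> // x.
  rewrite (le_trans (uM x))// -[X in _ <= _ * X]normr_id -normrM ger0_norm//.
  exact: le_trans (uM x).
have [M Mu] := choice ubound.
exists (\sum_(k < l) (M (b k) + M (a k))).
  by apply: sumr_ge0 => k _; rewrite addr_ge0//; apply: (Mu _).1.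
move=> x; rewrite mulr_suml; apply: ler_sum => k _.
rewrite (le_trans (ler_normB _ _))// mulrDl lerD//.
  exact: (Mu (b k)).2.
exact: (Mu (a k)).2.
Qed.

(** * Orbits of small variation: the first use of the category theorem *)

Lemma closure_near (F : set X) (x : X) (d : K) : 0 < d -> closure F x ->
  exists2 y, F y & `|x - y| < d.
Proof.
move=> d0 /(_ _ (nbhsx_ballx x _ d0))[y [Fy]].
by rewrite -ball_normE => ?; exists y.
Qed.

Definition variation_le1 (t : time) (delta : R) : set X :=
  [set x | forall l a b, short_family t delta l a b -> orbit_variation l a b x <= 1].

Lemma closed_variation_le1 (t : time) (delta : R) : closed (variation_le1 t delta).
Proof.
move=> x Fx l a b ab; apply/ler_addgt0Pr => e e0.
have [M M0 uM] := orbit_variation_bounded l a b.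
have M1 : 0 < M + 1 by rewrite ltr_wpDl.
have [|y Fy xy] := closure_near _ _ (e / (M + 1)) _ Fx; first exact: divr_gt0.
rewrite -(subrK y x) (le_trans (orbit_variationD _ _ _ _ _))//.
rewrite [leRHS]addrC lerD//; last exact: Fy.
rewrite (le_trans (uM _))//.
move: xy; rewrite ltr_pdivlMr// => /ltW; apply: le_trans.
by rewrite mulrC ler_wpM2l// lerDl.
Qed.

(** The scale [c] carries the homogeneity of seminorms: a bound [c] on the
ball of radius [c * r], for all [c] at once, replaces a Lipschitz bound with
constant [r^-1]. *)
Definition equicontinuous_variation (t : time) (delta : R) (r : K) :=
  forall (x : X) (c : K), 0 < c -> `|x| < c * r ->
  forall l a b, short_family t delta l a b -> orbit_variation l a b x <= c.

(** A vector of norm less than [r] is the difference of two points of the ball,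
so its variations are at most 2; homogeneity does the rest. *)
Lemma ball_equicontinuous (t : time) (delta : R) (x0 : X) (r : K) :
  ball x0 r `<=` variation_le1 t delta ->
  equicontinuous_variation t delta (r / 2).
Proof.
rewrite -ball_normE => rF x c c0 xc l a b ab.
have c20 : 0 < 2 / c by rewrite divr_gt0.
have xr : `|(2 / c) *: x| < r.
  rewrite normrZ gtr0_norm// -ltr_pdivlMl// invf_div.
  by rewrite mulrAC -mulrA.
have r0 : 0 < r by rewrite (le_lt_trans _ xr).
have Vx : orbit_variation l a b ((2 / c) *: x) <= 2.
  rewrite -[(2 / c) *: x](addrK x0) (le_trans (orbit_variationB _ _ _ _ _))//.
  rewrite -[leRHS]/(1 + 1) lerD//.
    by apply: (rF) ab; rewrite /ball_ /= opprD addrCA subrr addr0 normrN.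
  by apply: (rF) ab; rewrite /ball_ /= subrr normr0.
move: Vx; rewrite orbit_variationZ gtr0_norm// -ler_pdivlMl// invf_div.
by rewrite divfK ?pnatr_eq0.
Qed.

(** * The subspaces of absolutely continuous orbits: the second use *)

Definition ac_vectors (t : time) : set X :=
  [set x | absolutely_continuous_on (orbit_of u x) `]t, +oo[].

Lemma ac_vectorsB (t : time) (x y : X) :
  ac_vectors t x -> ac_vectors t y -> ac_vectors t (x - y).
Proof.
move=> /absolutely_continuousP xac /absolutely_continuousP yac.
apply/absolutely_continuousP => eps eps0.
have e0 : 0 < eps / 2 by rewrite divr_gt0.
have [d d0 dx] := xac _ e0; have [d' d'0 dy] := yac _ e0.
exists (Num.min d d'); first by rewrite lt_min d0 d'0.
move=> l a b ab; rewrite (le_lt_trans (orbit_variationB _ _ _ _ _))//.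
rewrite [ltRHS](splitr eps) ltrD//.
  by apply: dx; apply: short_family_le ab => //; rewrite ge_min lexx.
by apply: dy; apply: short_family_le ab => //; rewrite ge_min lexx orbT.
Qed.

Lemma ac_vectorsZ (t : time) (c : K) (x : X) :
  ac_vectors t x -> ac_vectors t (c *: x).
Proof.
have [-> xac|c0 /absolutely_continuousP xac] := eqVneq c 0.
  by rewrite scale0r -(subrr x); exact: ac_vectorsB.
apply/absolutely_continuousP => eps eps0.
have [|d d0 dx] := xac (eps / `|c|); first by rewrite divr_gt0 ?normr_gt0.
exists d => // l a b ab; rewrite -[ltLHS]/(orbit_variation l a b (c *: x)).
rewrite orbit_variationZ mulrC -ltr_pdivlMr ?normr_gt0//; exact: dx.
Qed.

(** A vector in the closure differs from some [y] in the subspace by a vector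
whose variations are at most [eps / 2], by equicontinuity; the orbit of [y]
accounts for the other half on shorter families. *)
Lemma closed_ac_vectors (t t' : time) (delta : R) (r : K) :
  0 < delta -> 0 < r -> equicontinuous_variation t delta r ->
  t <= t' -> closed (ac_vectors t').
Proof.
move=> delta0 r0 ur tt x Ax; apply/absolutely_continuousP => eps eps0.
have e0 : 0 < eps / 2 by rewrite divr_gt0.
have [|y /absolutely_continuousP yac xy] := closure_near _ _ (eps / 2 * r) _ Ax.
  exact: mulr_gt0.
have [d d0 dy] := yac _ e0.
exists (Num.min delta d); first by rewrite lt_min delta0 d0.
move=> l a b ab.
rewrite -[x](subrK y) (le_lt_trans (orbit_variationD _ _ _ _ _))//.
rewrite [ltRHS](splitr eps) ler_ltD//.
  apply: (ur _ _ e0 xy); apply: short_family_le ab => //.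
  by rewrite ge_min lexx.
by apply: dy; apply: short_family_le ab => //; rewrite ge_min lexx orbT.
Qed.

(** Any vector is a multiple of a difference of two points of the ball. *)
Lemma ball_ac_vectors (t : time) (x0 : X) (r : K) :
  0 < r -> ball x0 r `<=` ac_vectors t -> forall x, ac_vectors t x.
Proof.
move=> r0; rewrite -ball_normE => rA x.
(* Adding 1 to the norm keeps the scaling factor meaningful for [x = 0]. *)
have n0 : 0 < `|x| + 1 by rewrite ltr_wpDl.
have s0 : 0 < r / (`|x| + 1) by rewrite divr_gt0.
rewrite -[x](scalerK (lt0r_neq0 s0)); apply: ac_vectorsZ.
rewrite -[_ *: x](addrK x0); apply: ac_vectorsB; apply: rA.
  rewrite /ball_ /= opprD addrCA subrr addr0 normrN normrZ gtr0_norm//.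
  by rewrite mulrAC ltr_pdivrMr// ltr_pM2l// ltrDl.
by rewrite /ball_ /= subrr normr0.
Qed.

Lemma eventually_ac_uniform : archimedean_scalars K ->
  (forall x, exists t, ac_vectors t x) -> exists t, forall x, ac_vectors t x.
Proof.
move=> Karch uac.
have nat_above (t : time) : exists n : nat, t%:num <= n%:R.
  by exists (Num.truncn t%:num).+1; rewrite ltW// truncnS_gt.
(* One index bounds both the starting time and the length of the families:
   these sets grow when the time increases and the length decreases. *)
have [n [x0 [r [r0 rF]]]] : exists n x (r : K), 0 < r /\
    ball x r `<=` variation_le1 n%:R%:nng n.+1%:R^-1.
  apply: (closed_cover_ball (fun n => variation_le1 n%:R%:nng n.+1%:R^-1)) => //.
    by move=> n; exact: closed_variation_le1.
  move=> x; have [t /absolutely_continuousP/(_ 1 ltr01)[d d0 dx]] := uac x.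
  have [n tn] := nat_above t; have [m md] := realType_archimedean _ _ d0.
  exists (maxn n m) => l a b ab; apply/ltW/dx.
  apply: short_family_le ab.
    by rewrite -num_le /= (le_trans tn)// ler_nat leq_maxl.
  by rewrite (le_trans _ (ltW md))// lef_pV2 ?posrE// ler_nat ltnS leq_maxr.
have ur := ball_equicontinuous _ _ _ _ rF.
have r20 : 0 < r / 2 by rewrite divr_gt0.
have [m [x1 [s [s0 sA]]]] : exists m x (s : K), 0 < s /\
    ball x s `<=` ac_vectors (n%:R + m%:R)%:nng.
  apply: (closed_cover_ball (fun m => ac_vectors (n%:R + m%:R)%:nng)) => //.
    move=> m; apply: closed_ac_vectors ur _ => //.
    by rewrite -num_le /= lerDl.
  move=> x; have [t xac] := uac x; have [m tm] := nat_above t; exists m.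
  apply: absolutely_continuous_le xac.
  by rewrite -num_le /= (le_trans tm)// lerDr.
by exists (n%:R + m%:R)%:nng; exact: ball_ac_vectors sA.
Qed.

End OrbitVariation.

Theorem proposition3p10 (R : realType) (K : numFieldType)
    (hK : real_or_complex R K) (X Y : completeNormedModType K)
    (u : {nonneg R} -> bounded_operator X Y) :
  (forall x : X, exists t_x : {nonneg R},
     absolutely_continuous_on (orbit_of u x) `]t_x, +oo[) <->
  (exists t : {nonneg R}, forall x : X,
     absolutely_continuous_on (orbit_of u x) `]t, +oo[).
Proof.
split=> [uac|[t uac] x]; last by exists t.
exact: eventually_ac_uniform (real_or_complex_archimedean _ _ hK) uac.
Qed.
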